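(* Let $H$ and $K$ be finite subgroups of a group $G$ with $H\cap K=\{e\}$ and $HK\cap KH=H\cup K$. Let $\Omega=\{(h,k)\in H\times K:h=e\text{ or }k=e\}$. Let $A$ be the $^*$-subalgebra of $A_0=F(H)\otimes\mathbb C K$ of functions on $H\times K$ with support in $\Omega$, and $B$ the $^*$-subalgebra of $B_0=\mathbb C H\otimes F(K)$ of functions on $H\times K$ with support in $\Omega$. Then the pairing $\langle f,g\rangle=\sum_{(h,k)\in\Omega}f(h,k)g(h,k)$ of $A$ with $B$ makes $A$ and $B$ into a dual pair of finite $^*$-quantum hypergroups.
   Context: $F(H)$, $F(K)$ are the algebras of complex functions with pointwise operations and $\mathbb C H$, $\mathbb C K$ the group algebras. Elements of $A_0$ and $B_0$ are identified with complex functions on $H\times K$. In $A_0$: $(ff')(h,k)=\sum_{v\in K} f(h,v)f'(h,v^{-1}k)$ and $f^*(h,k)=\overline{f(h,k^{-1})}$. In $B_0$: $(gg')(h,k)=\sum_{u\in H}g(hu^{-1},k)g'(u,k)$ and $g^*(h,k)=\overline{g(h^{-1},k)}$. Under the assumption $HK\cap KH=H\cup K$, the set $\Omega$ is also $\{(h,k)\in H\times K:hk\in KH\}$. For a non-degenerate bilinear pairing of finite-dimensional unital algebras $A,B$ over $\mathbb C$, the induced coproducts are given by $\langle\Delta(a),b\otimes b'\rangle=\langle a,bb'\rangle$ and $\langle a\otimes a',\Delta(b)\rangle=\langle aa',b\rangle$; the induced counits are $\varepsilon(a)=\langle a,1\rangle$, $\varepsilon(b)=\langle 1,b\rangle$.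 A linear functional $\omega$ on $A$ is faithful if $\omega(ac)=0$ for all $c$ implies $a=0$, and $\omega(ac)=0$ for all $a$ implies $c=0$. A linear functional $\varphi$ on $(A,\Delta)$ is a left integral if there is a linear map $S:A\to A$ with $S((\iota\otimes\varphi)(\Delta(a)(1\otimes c)))=(\iota\otimes\varphi)((1\otimes a)\Delta(c))$ for all $a,c\in A$ ($\iota$ the identity map). If $\varphi$ is faithful, $S$ is unique and called the antipode of $\varphi$. A finite quantum hypergroup is a finite-dimensional unital algebra $A$ with a coassociative linear map $\Delta:A\to A\otimes A$ (not assumed multiplicative) admitting a counit, such that there is a faithful left integral, $\Delta(1)=1\otimes1$, the counit is an algebra homomorphism, and the antipode of the integral is an anti-isomorphism of the algebra $A$. It is a finite $^*$-quantum hypergroup if moreover $A$ is a $^*$-algebra and $\Delta(a^* )=\Delta(a)^*$ for all $a$. ''Dual pair of finite $^*$-quantum hypergroups'' means: the pairing is non-degenerate, both algebras with the coproducts induced by the pairing are finite $^*$-quantum hypergroups, and the involutions are related by $\langle a,b^*\rangle=\overline{\langle S(a)^*,b\rangle}$ with $S$ the antipode of $A$; i.e. each is the dual of the other. *)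

(* Defs.v *)
From HB Require Import structures.
From mathcomp Require Import all_boot all_order all_algebra all_fingroup all_field.
From mathcomp Require Import finmap.
From mathcomp Require Import complex.
From mathcomp Require Import reals.
Set Implicit Arguments.
Unset Strict Implicit.
Unset Printing Implicit Defensive.
Import Order.TTheory GRing.Theory Num.Theory.
Local Open Scope ring_scope.

Section TensorProduct.
Variable C : fieldType.
Implicit Types U V W : vectType C.

(* The library has no tensor product of abstract vector spaces: elements of   *)
(* U (x) V are represented by their coordinates in the chosen bases of U and  *)
(* V.  The universal property is [tlift_tens] together with [tensor_ext].     *)
Definition tensor U V : vectType C := 'M[C]_(\dim {:U}, \dim {:V}).

Definition tens U V (u : U) (v : V) : tensor U V :=
  \matrix_(i, j) (coord (vbasis {:U}) i u * coord (vbasis {:V}) j v).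

Definition tlift U V W (phi : U -> V -> W) (t : tensor U V) : W :=
  \sum_i \sum_j t i j *: phi (vbasis {:U})`_i (vbasis {:V})`_j.

Definition is_bilinear U V W (phi : U -> V -> W) :=
  bilinear_for *:%R *:%R phi.

Lemma tens_bilinear U V : is_bilinear (@tens U V).
Proof.
split=> [v a x y|u a x y]; apply/matrixP=> i j; rewrite !mxE linearP /=.
  by rewrite mulrDl mulrA.
by rewrite mulrDr mulrCA.
Qed.

Lemma tlift_linear U V W (phi : U -> V -> W) : linear (tlift phi).
Proof.
move=> a s t; rewrite /tlift scaler_sumr -big_split; apply: eq_bigr => i _ /=.
rewrite scaler_sumr -big_split; apply: eq_bigr => j _ /=.
by rewrite !mxE scalerDl scalerA.
Qed.

HB.instance Definition _ U V W (phi : U -> V -> W) :=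
  GRing.isLinear.Build C (tensor U V) W *:%R (tlift phi) (tlift_linear phi).

Fact linear_comb U W (f : U -> W) n (a : 'I_n -> C) (e : 'I_n -> U) :
  linear f -> f (\sum_i a i *: e i) = \sum_i a i *: f (e i).
Proof.
move=> lf; have fD x y : f (x + y) = f x + f y by have := lf 1 x y; rewrite !scale1r.
have f0 : f 0 = 0 by apply: (addrI (f 0)); rewrite -fD !addr0.
elim/big_rec2: _ => // i y x _ <-; exact: lf.
Qed.

Lemma tlift_tens U V W (phi : U -> V -> W) u v :
  is_bilinear phi -> tlift phi (tens u v) = phi u v.
Proof.
case=> phil phir; have uE := coord_vbasis (memvf u).
have vE := coord_vbasis (memvf v).
have -> : phi u v = phi (\sum_i coord (vbasis {:U}) i u *: (vbasis {:U})`_i) v.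
  by congr (phi _ v).
rewrite (linear_comb _ _ (phil v)); apply: eq_bigr => i _.
have -> : phi (vbasis {:U})`_i v = phi (vbasis {:U})`_i
    (\sum_j coord (vbasis {:V}) j v *: (vbasis {:V})`_j).
  by congr (phi _ _).
rewrite (linear_comb _ _ (phir _)) scaler_sumr; apply: eq_bigr => j _.
by rewrite mxE scalerA.
Qed.

Lemma tensor_span U V (t : tensor U V) :
  t = \sum_i \sum_j t i j *: tens (vbasis {:U})`_i (vbasis {:V})`_j.
Proof.
have fU := basis_free (vbasisP {:U}); have fV := basis_free (vbasisP {:V}).
rewrite [LHS]matrix_sum_delta; apply: eq_bigr => i _; apply: eq_bigr => j _.
congr (_ *: _); apply/matrixP=> k l.
by rewrite !mxE !coord_free // -natrM mulnb (eq_sym k) (eq_sym l).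
Qed.

Lemma tensor_ext U V W (f g : {linear tensor U V -> W}) :
  (forall u v, f (tens u v) = g (tens u v)) -> f =1 g.
Proof.
move=> fg t; rewrite (tensor_span t) !linear_sum; apply: eq_bigr => i _.
by rewrite !linear_sum; apply: eq_bigr => j _; rewrite !linearZ fg.
Qed.

Definition tmap U V U' V' (f : U -> U') (g : V -> V') :
    tensor U V -> tensor U' V' :=
  tlift (fun u v => tens (f u) (g v)).

(* u (x) v |-> g v *: u and u (x) v |-> f u *: v, i.e. id (x) g and f (x) id  *)
(* followed by the identification of U (x) C with U and of C (x) V with V.    *)
Definition slicer U V (g : V -> C) : tensor U V -> U :=
  tlift (fun u v => g v *: u).
Definition slicel U V (f : U -> C) : tensor U V -> V :=
  tlift (fun u v => f u *: v).

Definition tassoc U V W : tensor (tensor U V) W -> tensor U (tensor V W) :=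
  tlift (fun (t : tensor U V) w => tlift (fun u v => tens u (tens v w)) t).

Definition tpair U V U' V' (p : U -> V -> C) (q : U' -> V' -> C)
    (s : tensor U U') (t : tensor V V') : C :=
  tlift (fun u u' => tlift (fun v v' => p u v * q u' v' : C^o) t : C^o) s.

End TensorProduct.

Definition tmul (C : fieldType) (A : falgType C) (s t : tensor A A) :
    tensor A A :=
  tlift (fun a b => tlift (fun a' b' => tens (a * a') (b * b')) t) s.

(* The conjugate-linear extension of a (x) b |-> star a (x) star b. *)
Definition tstar (C : numClosedFieldType) (A : falgType C) (star : A -> A)
    (t : tensor A A) : tensor A A :=
  tlift (fun a b => tens (star a) (star b)) (map_mx Num.conj t).

Section QuantumHypergroups.
Variables (C : numClosedFieldType) (A : falgType C).
Implicit Types (Delta : {linear A -> tensor A A}) (phi eps : {scalar A}).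
Implicit Types (S : {linear A -> A}) (star : A -> A).

Definition coassociative Delta :=
  forall a, tassoc (tmap Delta idfun (Delta a)) = tmap idfun Delta (Delta a).

Definition is_counit Delta eps :=
  forall a, slicel eps (Delta a) = a /\ slicer eps (Delta a) = a.

Definition faithful phi :=
  (forall a, (forall c, phi (a * c) = 0) -> a = 0) /\
  (forall c, (forall a, phi (a * c) = 0) -> c = 0).

(* phi is a left integral, and S is the antipode of phi *)
Definition left_integral_with Delta phi S :=
  forall a c, S (slicer phi (tmul (Delta a) (tens 1 c)))
              = slicer phi (tmul (tens 1 a) (Delta c)).

Definition anti_isomorphism S :=
  bijective S /\ forall a b, S (a * b) = S b * S a.

(* S is the antipode of the finite quantum hypergroup (A, Delta).  Without    *)
(* the last condition S could depend on phi: if A = C[K] with group-like      *)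
(* Delta k = k (x) k, then, for every x in K, the coefficient at x is a       *)
(* faithful left integral, with S k = k^-1 x.                                 *)
Definition is_antipode Delta S :=
  exists phi, [/\ faithful phi, left_integral_with Delta phi S &
                  anti_isomorphism S].

Definition finite_quantum_hypergroup Delta :=
  [/\ coassociative Delta,
      Delta 1 = tens 1 1,
      exists eps, is_counit Delta eps /\ monoid_morphism eps &
      exists S, is_antipode Delta S].

Definition is_involution star :=
  [/\ forall (x : C) a b, star (x *: a + b) = x^* *: star a + star b,
      forall a b, star (a * b) = star b * star a &
      involutive star].

Definition finite_star_quantum_hypergroup star Delta :=
  [/\ finite_quantum_hypergroup Delta,
      is_involution star &
      forall a, Delta (star a) = tstar star (Delta a)].

End QuantumHypergroups.

Section DualPairs.
Variables (C : numClosedFieldType) (A B : falgType C).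
Implicit Types (pair : A -> B -> C).

Definition nondegenerate pair :=
  (forall a, (forall b, pair a b = 0) -> a = 0) /\
  (forall b, (forall a, pair a b = 0) -> b = 0).

Definition induced_coproductl pair (Delta : A -> tensor A A) :=
  forall a b b', tpair pair pair (Delta a) (tens b b') = pair a (b * b').

Definition induced_coproductr pair (Delta : B -> tensor B B) :=
  forall a a' b, tpair pair pair (tens a a') (Delta b) = pair (a * a') b.

(* The induced coproducts are unique as the pairing is non-degenerate, and    *)
(* their counits are unique, hence equal to pair ^~ 1 and pair 1.             *)
Definition dual_pair_of_finite_star_quantum_hypergroups
    (starA : A -> A) (starB : B -> B) pair :=
  [/\ bilinear_for *%R *%R pair,
      nondegenerate pair &
      exists (DeltaA : {linear A -> tensor A A})
             (DeltaB : {linear B -> tensor B B}),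
        [/\ induced_coproductl pair DeltaA,
            induced_coproductr pair DeltaB,
            finite_star_quantum_hypergroup starA DeltaA,
            finite_star_quantum_hypergroup starB DeltaB &
            forall S, is_antipode DeltaA S ->
              forall a b, pair a (starB b) = (pair (starA (S a)) b)^*]].

End DualPairs.

Section FunctionAlgebras.
Variables (C : numClosedFieldType) (H K : finGroupType).

(* F(H) (x) C[K] and C[H] (x) F(K) as two algebra structures on the complex   *)
(* functions on H * K; they are distinct types as the products differ.        *)
Definition FHxCK := {ffun H * K -> C^o}.
Definition CHxFK := {ffun H * K -> C^o}.

HB.instance Definition _ := Vector.copy FHxCK {ffun H * K -> C^o}.
HB.instance Definition _ := Vector.copy CHxFK {ffun H * K -> C^o}.

Definition mulA0 (f f' : FHxCK) : FHxCK :=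
  [ffun x => \sum_(v : K) f (x.1, v) * f' (x.1, (v^-1 * x.2)%g)].
Definition oneA0 : FHxCK := [ffun x => (x.2 == 1%g)%:R].
Definition starA0 (f : FHxCK) : FHxCK := [ffun x => (f (x.1, x.2^-1%g))^*].

Definition mulB0 (g g' : CHxFK) : CHxFK :=
  [ffun x => \sum_(u : H) g ((x.1 * u^-1)%g, x.2) * g' (u, x.2)].
Definition oneB0 : CHxFK := [ffun x => (x.1 == 1%g)%:R].
Definition starB0 (g : CHxFK) : CHxFK := [ffun x => (g (x.1^-1%g, x.2))^*].

Fact mulA0A : associative mulA0.
Proof.
move=> f g l; apply/ffunP=> -[h k]; rewrite !ffunE /=.
under eq_bigr => v _ do rewrite ffunE mulr_sumr /=.
under [RHS]eq_bigr => w _ do rewrite ffunE mulr_suml /=.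
rewrite [RHS]exchange_big /=; apply: eq_bigr => v _.
rewrite [RHS](reindex_inj (mulgI v)) /=; apply: eq_bigr => w _.
by rewrite mulKg invMg !mulgA mulrA.
Qed.

Fact mul1A0 : left_id oneA0 mulA0.
Proof.
move=> f; apply/ffunP=> -[h k]; rewrite !ffunE /=.
rewrite (bigD1 1%g) //= big1 => [|v /negPf v1]; rewrite ffunE /=.
  by rewrite eqxx mul1r invg1 mul1g addr0.
by rewrite v1 mul0r.
Qed.

Fact mulA01 : right_id oneA0 mulA0.
Proof.
move=> f; apply/ffunP=> -[h k]; rewrite !ffunE /=.
rewrite (bigD1 k) //= big1 => [|v vk]; rewrite ffunE /=.
  by rewrite mulVg eqxx mulr1 addr0.
by rewrite -eq_mulVg1 (negPf vk) mulr0.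
Qed.

Fact mulA0Dl : left_distributive mulA0 +%R.
Proof.
move=> f g l; apply/ffunP=> x; rewrite !ffunE -big_split /=.
by apply: eq_bigr => v _; rewrite !ffunE mulrDl.
Qed.

Fact mulA0Dr : right_distributive mulA0 +%R.
Proof.
move=> f g l; apply/ffunP=> x; rewrite !ffunE -big_split /=.
by apply: eq_bigr => v _; rewrite !ffunE mulrDr.
Qed.

Fact oneA0_neq0 : oneA0 != 0.
Proof.
apply/eqP=> /ffunP/(_ (1%g, 1%g)); rewrite !ffunE eqxx.
by move/eqP; rewrite oner_eq0.
Qed.

HB.instance Definition _ := GRing.Zmodule_isNzRing.Build FHxCK
  mulA0A mul1A0 mulA01 mulA0Dl mulA0Dr oneA0_neq0.

Fact scaleA0Al (x : C) (f g : FHxCK) : x *: (f * g) = (x *: f) * g.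
Proof.
apply/ffunP=> y; rewrite !ffunE scaler_sumr.
by apply: eq_bigr => v _; rewrite !ffunE scalerAl.
Qed.

Fact scaleA0Ar (x : C) (f g : FHxCK) : x *: (f * g) = f * (x *: g).
Proof.
apply/ffunP=> y; rewrite !ffunE scaler_sumr.
by apply: eq_bigr => v _; rewrite !ffunE scalerAr.
Qed.

HB.instance Definition _ := GRing.Lmodule_isLalgebra.Build C FHxCK scaleA0Al.
HB.instance Definition _ := GRing.Lalgebra_isAlgebra.Build C FHxCK scaleA0Ar.
HB.instance Definition _ := Algebra_isFalgebra.Build C FHxCK.

Fact mulB0A : associative mulB0.
Proof.
move=> f g l; apply/ffunP=> -[h k]; rewrite !ffunE /=.
under eq_bigr => v _ do rewrite ffunE mulr_sumr /=.
under [RHS]eq_bigr => w _ do rewrite ffunE mulr_suml /=.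
rewrite exchange_big /=; apply: eq_bigr => v _.
rewrite (reindex_inj (mulIg v)) /=; apply: eq_bigr => w _.
by rewrite mulgK invMg !mulgA mulrA.
Qed.

Fact mul1B0 : left_id oneB0 mulB0.
Proof.
move=> f; apply/ffunP=> -[h k]; rewrite !ffunE /=.
rewrite (bigD1 h) //= big1 => [|v vh]; rewrite ffunE /=.
  by rewrite mulgV eqxx mul1r addr0.
by rewrite -eq_mulgV1 eq_sym (negPf vh) mul0r.
Qed.

Fact mulB01 : right_id oneB0 mulB0.
Proof.
move=> f; apply/ffunP=> -[h k]; rewrite !ffunE /=.
rewrite (bigD1 1%g) //= big1 => [|v /negPf v1]; rewrite ffunE /=.
  by rewrite eqxx mulr1 invg1 mulg1 addr0.
by rewrite v1 mulr0.
Qed.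

Fact mulB0Dl : left_distributive mulB0 +%R.
Proof.
move=> f g l; apply/ffunP=> x; rewrite !ffunE -big_split /=.
by apply: eq_bigr => v _; rewrite !ffunE mulrDl.
Qed.

Fact mulB0Dr : right_distributive mulB0 +%R.
Proof.
move=> f g l; apply/ffunP=> x; rewrite !ffunE -big_split /=.
by apply: eq_bigr => v _; rewrite !ffunE mulrDr.
Qed.

Fact oneB0_neq0 : oneB0 != 0.
Proof.
apply/eqP=> /ffunP/(_ (1%g, 1%g)); rewrite !ffunE eqxx.
by move/eqP; rewrite oner_eq0.
Qed.

HB.instance Definition _ := GRing.Zmodule_isNzRing.Build CHxFK
  mulB0A mul1B0 mulB01 mulB0Dl mulB0Dr oneB0_neq0.

Fact scaleB0Al (x : C) (f g : CHxFK) : x *: (f * g) = (x *: f) * g.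
Proof.
apply/ffunP=> y; rewrite !ffunE scaler_sumr.
by apply: eq_bigr => v _; rewrite !ffunE scalerAl.
Qed.

Fact scaleB0Ar (x : C) (f g : CHxFK) : x *: (f * g) = f * (x *: g).
Proof.
apply/ffunP=> y; rewrite !ffunE scaler_sumr.
by apply: eq_bigr => v _; rewrite !ffunE scalerAr.
Qed.

HB.instance Definition _ := GRing.Lmodule_isLalgebra.Build C CHxFK scaleB0Al.
HB.instance Definition _ := GRing.Lalgebra_isAlgebra.Build C CHxFK scaleB0Ar.
HB.instance Definition _ := Algebra_isFalgebra.Build C CHxFK.

Definition Omega : {set H * K} := [set x | (x.1 == 1%g) || (x.2 == 1%g)].

(* The functions with support in Omega, as the kernel of the restriction to   *)
(* the complement of Omega; see [mem_suppOmega].                              *)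
Definition off_Omega (f : {ffun H * K -> C^o}) : {ffun H * K -> C^o} :=
  [ffun x => if x \in Omega then 0 else f x].

Fact off_Omega_linear : linear off_Omega.
Proof.
move=> a f g; apply/ffunP=> x; rewrite !ffunE.
by case: ifP; rewrite ?scaler0 ?addr0.
Qed.

HB.instance Definition _ := GRing.isLinear.Build C {ffun H * K -> C^o}
  {ffun H * K -> C^o} *:%R off_Omega off_Omega_linear.

Definition suppOmega : {vspace {ffun H * K -> C^o}} := lker (linfun off_Omega).

Lemma mem_suppOmega (f : {ffun H * K -> C^o}) :
  (f \in suppOmega) = (support f \subset Omega).
Proof.
rewrite memv_ker lfunE /=; apply/eqP/subsetP=> [/ffunP f0 x|fO].
  by rewrite inE => nzfx; move: (f0 x); rewrite !ffunE; case: ifP => // _ /eqP;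
     rewrite (negPf nzfx).
apply/ffunP=> x; rewrite !ffunE; case: ifPn => // nOx.
by apply/eqP; apply: contraNT nOx => nzfx; apply: fO.
Qed.

Lemma suppOmegaP (f : {ffun H * K -> C^o}) :
  reflect (forall h k, h != 1%g -> k != 1%g -> f (h, k) = 0)
          (f \in suppOmega).
Proof.
rewrite mem_suppOmega; apply: (iffP subsetP) => [fO h k h1 k1|f0 [h k]].
  apply/eqP; apply: contraTT isT => /(fO (h, k)).
  by rewrite !inE /= (negPf h1) (negPf k1).
rewrite !inE /=; apply: contraR; rewrite negb_or => /andP[h1 k1].
by rewrite f0.
Qed.

Fact suppA_is_aspace : is_aspace (suppOmega : {vspace FHxCK}).
Proof.
rewrite /is_aspace has_algid1; last first.
  by apply/suppOmegaP => h k _ /negPf k1; rewrite ffunE /= k1.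
apply/prodvP => f f' /suppOmegaP f0 /suppOmegaP f'0.
apply/suppOmegaP => h k h1 k1; rewrite ffunE big1 //= => v _.
have [->|v1] := eqVneq v 1%g; last by rewrite f0 ?mul0r.
by rewrite invg1 mul1g f'0 ?mulr0.
Qed.

Fact suppB_is_aspace : is_aspace (suppOmega : {vspace CHxFK}).
Proof.
rewrite /is_aspace has_algid1; last first.
  by apply/suppOmegaP => h k /negPf h1 _; rewrite ffunE /= h1.
apply/prodvP => g g' /suppOmegaP g0 /suppOmegaP g'0.
apply/suppOmegaP => h k h1 k1; rewrite ffunE big1 //= => u _.
have [->|u1] := eqVneq u 1%g; last by rewrite g'0 ?mulr0.
by rewrite invg1 mulg1 g0 ?mul0r.
Qed.

Definition suppA : {aspace FHxCK} := ASpace suppA_is_aspace.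
Definition suppB : {aspace CHxFK} := ASpace suppB_is_aspace.

Fact starA0_suppA f : f \in suppA -> starA0 f \in suppA.
Proof.
move/suppOmegaP => f0; apply/suppOmegaP => h k h1 k1.
by rewrite ffunE /= f0 ?invg_eq1 // rmorph0.
Qed.

Fact starB0_suppB g : g \in suppB -> starB0 g \in suppB.
Proof.
move/suppOmegaP => g0; apply/suppOmegaP => h k h1 k1.
by rewrite ffunE /= g0 ?invg_eq1 // rmorph0.
Qed.

Definition algA : falgType C := subvs_of suppA.
Definition algB : falgType C := subvs_of suppB.

Lemma one_algA : vsval (1 : algA) = 1 :> FHxCK.
Proof.
apply/eqP; rewrite algid_eq1.
by apply/suppOmegaP => h k _ /negPf k1; rewrite ffunE /= k1.
Qed.

Lemma one_algB : vsval (1 : algB) = 1 :> CHxFK.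
Proof.
apply/eqP; rewrite algid_eq1.
by apply/suppOmegaP => h k /negPf h1 _; rewrite ffunE /= h1.
Qed.

Definition starA (f : algA) : algA := Subvs (starA0_suppA (subvsP f)).
Definition starB (g : algB) : algB := Subvs (starB0_suppB (subvsP g)).

Definition pairAB (f : algA) (g : algB) : C :=
  \sum_(x in Omega) (vsval f : FHxCK) x * (vsval g : CHxFK) x.

End FunctionAlgebras.

Section FiniteSubgroups.
Variable G : groupType.
Local Open Scope group_scope.
Local Open Scope fset_scope.

Record fin_subgroup := FinSubgroup {
  fin_subgroup_set :> {fset G};
  fin_subgroup_closed : group_closed [in fin_subgroup_set]
}.

Definition fsubg (H : fin_subgroup) : Type := fset_sub_type H.

HB.instance Definition _ H := [isSub for @fsval _ _ : fsubg H -> G].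
HB.instance Definition _ H := Finite.on (fsubg H).
HB.instance Definition _ H :=
  SubChoice_isSubGroup.Build G _ (fsubg H) (fin_subgroup_closed H).

Definition set_prod (A B : {fset G}) : {fset G} :=
  [fset a * b | a in A, b in B].

End FiniteSubgroups.

(* Main.v *)
From HB Require Import structures.
Require Import Defs.
From mathcomp Require Import all_boot all_order all_algebra all_fingroup all_field.
From mathcomp Require Import finmap complex reals.
Set Implicit Arguments.
Unset Strict Implicit.
Unset Printing Implicit Defensive.
Import GRing.Theory Num.Theory.
Local Open Scope ring_scope.

(* Let d(h,k), for (h,k) in Omega, be the delta functions, and d(h,k) = 0      *)
(* outside Omega.  Dually to the product of B, the coproduct of A is           *)
(*   Delta d(h,k) = sum_p d(p,k) (x) d(p^-1 h,k),                              *)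
(* an identity which persists outside Omega: there k <> 1, so that a nonzero   *)
(* factor d(p,k) requires p = 1, and d(p^-1 h,k) = 0.  All conditions can      *)
(* therefore be checked on all pairs (h,k) as in F(H) (x) C[K], with           *)
(*   counit f |-> sum_k f(1,k), left integral phi f = sum_h f(h,1),            *)
(*   antipode (S f)(h,k) = f(h^-1,k^-1),                                       *)
(* using phi (d(h,k) f) = phi (f d(h,k)) = f(h,k^-1).  Exchanging H and K      *)
(* turns B into an algebra of the same kind as A.                              *)

(** * Tensor products *)

(** The product of [A] is convolution in [K] over each point of [H]; the coproduct, being dual to
    the product of [B], splits [h] in [H] over a fixed [k]. Coassociativity, the counit and the
    antipode thus come from the group laws, as for finite groups. The axiom that really mixes
    product and coproduct is [integral_left]: the integral is a trace whose products with delta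
    functions are point values, so both sides have explicit coefficients, and where their support
    conditions disagree the delta function concerned is zero. [B] is an algebra of the same kind
    with [H] and [K] exchanged, so [Omega_algebra] is studied once and [Omega_dual_pair] applies it
    on both sides. Pairing with a delta function is evaluation, which gives non-degeneracy and
    [Delta_induced]. The relation between the involutions is required of every antipode;
    [antipode_unique] reduces it to [antipode]. *)

Section Tensors.
Variable C : fieldType.
Implicit Types U V W : vectType C.

(** Gives one half of bilinearity when a [tlift] is itself the map being lifted, as in [tassoc] and
    [tmul]. *)
Lemma tlift_linear_arg U V W X (phi : X -> U -> V -> W) (t : tensor U V) a x y z :
  (forall u v, phi z u v = a *: phi x u v + phi y u v) ->
  tlift (phi z) t = a *: tlift (phi x) t + tlift (phi y) t.
Proof.
move=> phiz; rewrite scaler_sumr -big_split /=; apply: eq_bigr => i _.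
rewrite scaler_sumr -big_split /=; apply: eq_bigr => j _.
by rewrite phiz scalerDr !scalerA mulrC.
Qed.

Lemma tens_linearl U V (v : V) : linear (fun u : U => tens u v).
Proof. by case: (tens_bilinear U V). Qed.

Lemma tens_linearr U V (u : U) : linear (fun v : V => tens u v).
Proof. by case: (tens_bilinear U V). Qed.

Lemma tens0l U V (v : V) : tens (0 : U) v = 0.
Proof. by apply/matrixP => i j; rewrite !mxE linear0 mul0r. Qed.

Lemma tens0r U V (u : U) : tens u (0 : V) = 0.
Proof. by apply/matrixP => i j; rewrite !mxE linear0 mulr0. Qed.

Lemma tens_suml U V I (r : seq I) (F : I -> U) (v : V) :
  tens (\sum_(i <- r) F i) v = \sum_(i <- r) tens (F i) v.
Proof.
apply/matrixP => i j; rewrite mxE linear_sum mulr_suml summxE.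
by apply: eq_bigr => k _; rewrite mxE.
Qed.

Lemma tens_sumr U V I (r : seq I) (u : U) (F : I -> V) :
  tens u (\sum_(i <- r) F i) = \sum_(i <- r) tens u (F i).
Proof.
apply/matrixP => i j; rewrite mxE linear_sum mulr_sumr summxE.
by apply: eq_bigr => k _; rewrite mxE.
Qed.

HB.instance Definition _ U V U' V' (f : U -> U') (g : V -> V') :=
  GRing.isLinear.Build C _ _ *:%R (tmap f g) (tlift_linear _).
HB.instance Definition _ U V (g : V -> C) :=
  GRing.isLinear.Build C (tensor U V) U *:%R (slicer g) (tlift_linear _).
HB.instance Definition _ U V (f : U -> C) :=
  GRing.isLinear.Build C (tensor U V) V *:%R (slicel f) (tlift_linear _).
HB.instance Definition _ U V W :=
  GRing.isLinear.Build C _ _ *:%R (@tassoc C U V W) (tlift_linear _).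

Lemma tlift_sum U V W (phi : U -> V -> W) I (r : seq I) (F : I -> tensor U V) :
  tlift phi (\sum_(i <- r) F i) = \sum_(i <- r) tlift phi (F i).
Proof. exact: linear_sum. Qed.

Lemma tmap_sum U V U' V' (f : U -> U') (g : V -> V') I (r : seq I)
    (F : I -> tensor U V) :
  tmap f g (\sum_(i <- r) F i) = \sum_(i <- r) tmap f g (F i).
Proof. exact: linear_sum. Qed.

Lemma slicer_sum U V (g : V -> C) I (r : seq I) (F : I -> tensor U V) :
  slicer g (\sum_(i <- r) F i) = \sum_(i <- r) slicer g (F i).
Proof. exact: linear_sum. Qed.

Lemma slicel_sum U V (f : U -> C) I (r : seq I) (F : I -> tensor U V) :
  slicel f (\sum_(i <- r) F i) = \sum_(i <- r) slicel f (F i).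
Proof. exact: linear_sum. Qed.

Lemma tassoc_sum U V W I (r : seq I) (F : I -> tensor (tensor U V) W) :
  tassoc (\sum_(i <- r) F i) = \sum_(i <- r) tassoc (F i).
Proof. exact: linear_sum. Qed.

Lemma tmap_tens U V U' V' (f : {linear U -> U'}) (g : {linear V -> V'}) u v :
  tmap f g (tens u v) = tens (f u) (g v).
Proof.
rewrite /tmap tlift_tens //.
by split=> [w a x y|w a x y]; rewrite linearP /= ?tens_linearl ?tens_linearr.
Qed.

Lemma slicer_tens U V (g : {scalar V}) (u : U) v : slicer g (tens u v) = g v *: u.
Proof.
rewrite /slicer tlift_tens //; split=> [w a x y|w a x y] /=.
  by rewrite scalerDr !scalerA mulrC.
by rewrite linearP /= scalerDl scalerA.
Qed.

Lemma slicel_tens U V (f : {scalar U}) u (v : V) : slicel f (tens u v) = f u *: v.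
Proof.
rewrite /slicel tlift_tens //; split=> [w a x y|w a x y] /=.
  by rewrite linearP /= scalerDl scalerA.
by rewrite scalerDr !scalerA mulrC.
Qed.

Lemma tassocE U V W (t : tensor U V) (w : W) :
  tassoc (tens t w) = tlift (fun u v => tens u (tens v w)) t.
Proof.
rewrite /tassoc tlift_tens //; split=> [x a s s'|s a x y]; first by rewrite linearP.
apply: (tlift_linear_arg (phi := fun w u v => tens u (tens v w))) => u v.
by rewrite !tens_linearr.
Qed.

Lemma tassoc_tens U V W (u : U) (v : V) (w : W) :
  tassoc (tens (tens u v) w) = tens u (tens v w).
Proof.
rewrite tassocE tlift_tens //.
by split=> [x a y z|x a y z]; rewrite ?tens_linearl ?tens_linearr.
Qed.

Lemma tmul_tensl (A : falgType C) (a b : A) t :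
  tmul (tens a b) t = tlift (fun a' b' => tens (a * a') (b * b')) t.
Proof.
rewrite /tmul tlift_tens //; split=> [x c y z|x c y z].
  apply: (tlift_linear_arg (phi := fun y a' b' => tens (y * a') (x * b'))) => u v.
  by rewrite mulrDl -scalerAl tens_linearl.
apply: (tlift_linear_arg (phi := fun y a' b' => tens (x * a') (y * b'))) => u v.
by rewrite mulrDl -scalerAl tens_linearr.
Qed.

Lemma tmul_tens (A : falgType C) (a b a' b' : A) :
  tmul (tens a b) (tens a' b') = tens (a * a') (b * b').
Proof.
rewrite tmul_tensl tlift_tens //.
by split=> [x c y z|x c y z]; rewrite mulrDr -scalerAr ?tens_linearl ?tens_linearr.
Qed.

Lemma tmul_suml (A : falgType C) I (r : seq I) (F : I -> tensor A A) t :
  tmul (\sum_(i <- r) F i) t = \sum_(i <- r) tmul (F i) t.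
Proof. exact: linear_sum. Qed.

Lemma tmul_tens_sumr (A : falgType C) (a b : A) I (r : seq I) (F : I -> tensor A A) :
  tmul (tens a b) (\sum_(i <- r) F i) = \sum_(i <- r) tmul (tens a b) (F i).
Proof. by rewrite tmul_tensl linear_sum; apply: eq_bigr => i _; rewrite tmul_tensl. Qed.

Lemma tpair_tensr U V U' V' (p : U -> V -> C) (q : U' -> V' -> C) s v v' :
  bilinear_for *%R *%R p -> bilinear_for *%R *%R q ->
  tpair p q s (tens v v') = tlift (fun u u' => p u v * q u' v' : C^o) s.
Proof.
move=> [pl pr] [ql qr]; apply: eq_bigr => i _; apply: eq_bigr => j _.
rewrite tlift_tens //; split=> [w a x y|w a x y] /=.
  by rewrite pr mulrDl -mulrA.
by rewrite qr mulrDr mulrCA.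
Qed.

(** Both sides are one fourfold sum over basis vectors. This turns an induced coproduct on the right
    into one on the left with the two algebras exchanged. *)
Lemma tpair_flip U V U' V' (p : U -> V -> C) (q : U' -> V' -> C) s t :
  tpair p q s t = tpair (fun v u => p u v) (fun v u => q u v) t s.
Proof.
rewrite /tpair /tlift.
under eq_bigr => i _ do under eq_bigr => j _ do
  (rewrite scaler_sumr; under eq_bigr => k _ do rewrite scaler_sumr).
under [RHS]eq_bigr => i _ do under eq_bigr => j _ do
  (rewrite scaler_sumr; under eq_bigr => k _ do rewrite scaler_sumr).
rewrite pair_big /=; under eq_bigr => i _ do rewrite pair_big /=.
rewrite [RHS]pair_big /=; under [RHS]eq_bigr => i _ do rewrite pair_big /=.
rewrite exchange_big /=; apply: eq_bigr => k _; apply: eq_bigr => i _.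
by rewrite !scalerA [s _ _ * _]mulrC.
Qed.

End Tensors.

Lemma semilinear_sum (C : numClosedFieldType) (U V : lmodType C) (f : U -> V)
    I (r : seq I) (c : I -> C) (F : I -> U) :
  (forall x a b, f (x *: a + b) = x^* *: f a + f b) ->
  f (\sum_(i <- r) c i *: F i) = \sum_(i <- r) (c i)^* *: f (F i).
Proof.
move=> fL; have f0 : f 0 = 0.
  apply: (addrI (f 0)); have := fL 1 0 0.
  by rewrite rmorph1 !scale1r !addr0 => <-.
elim/big_rec2: _ => // i y x _ <-; exact: fL.
Qed.

Section TensorStar.
Variables (C : numClosedFieldType) (A : falgType C) (star : A -> A).

(** [tstar] conjugates coordinates in a chosen basis; expanding [a] and [b] in that basis,
    semilinearity of [star] produces the same conjugates. *)
Lemma tstar_tens a b :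
  (forall (x : C) a b, star (x *: a + b) = x^* *: star a + star b) ->
  tstar star (tens a b) = tens (star a) (star b).
Proof.
move=> starL; rewrite {2}(coord_vbasis (memvf a)) {2}(coord_vbasis (memvf b)).
rewrite !(semilinear_sum _ _ _ starL) tens_suml.
apply: eq_bigr => i _; rewrite tens_sumr; apply: eq_bigr => j _.
by apply/matrixP => k l; rewrite !mxE !linearZ /= rmorphM mulrACA.
Qed.

Lemma tstar_semilinear c s t :
  tstar star (c *: s + t) = c^* *: tstar star s + tstar star t.
Proof.
rewrite /tstar -linearP; congr tlift; apply/matrixP => i j.
by rewrite !mxE rmorphD rmorphM.
Qed.

Lemma tstar_sum I (r : seq I) (F : I -> tensor A A) :
  tstar star (\sum_(i <- r) F i) = \sum_(i <- r) tstar star (F i).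
Proof.
under eq_bigr do rewrite -[F _]scale1r.
rewrite (semilinear_sum _ _ _ tstar_semilinear).
by apply: eq_bigr => i _; rewrite rmorph1 !scale1r.
Qed.

End TensorStar.

(** * Algebras of functions supported in Omega *)

Section OmegaAlgebra.
Variables (C : numClosedFieldType) (H K : finGroupType) (A : falgType C).
Variables (ev : H * K -> {scalar A}) (d : H * K -> A).

(* [A] is the algebra of functions on [H * K] supported in [Omega], through   *)
(* its evaluations [ev] and its delta functions [d] (zero outside [Omega]).   *)
Record Omega_algebra : Prop := {
  ev_delta : forall x y, ev x (d y) = ((x \in Omega H K) && (x == y))%:R;
  ev_sum : forall a, a = \sum_x ev x a *: d x;
  ev_mul : forall h k a b,
    ev (h, k) (a * b) = \sum_v ev (h, v) a * ev (h, (v^-1 * k)%g) b;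
  ev_one : forall h k, ev (h, k) 1 = (k == 1%g)%:R }.

Definition delta_ext (W : vectType C) (F : H * K -> W) (a : A) : W :=
  \sum_x ev x a *: F x.

Fact delta_ext_linear (W : vectType C) (F : H * K -> W) : linear (delta_ext F).
Proof.
move=> c a b; rewrite /delta_ext scaler_sumr -big_split; apply: eq_bigr => x _ /=.
by rewrite linearP scalerDl scalerA.
Qed.

HB.instance Definition _ (W : vectType C) (F : H * K -> W) :=
  GRing.isLinear.Build C A W *:%R (@delta_ext W F) (@delta_ext_linear W F).

Definition Delta : {linear A -> tensor A A} :=
  delta_ext (fun x => \sum_p tens (d (p, x.2)) (d ((p^-1 * x.1)%g, x.2))).

Definition antipode : {linear A -> A} :=
  delta_ext (fun x => d (x.1^-1, x.2^-1)%g).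

Definition counit_Omega (a : A) : C := \sum_k ev (1%g, k) a.

Fact counit_Omega_scalar : scalar counit_Omega.
Proof.
move=> c a b; rewrite /counit_Omega mulr_sumr -big_split; apply: eq_bigr => k _ /=.
by rewrite linearP.
Qed.

HB.instance Definition _ :=
  GRing.isLinear.Build C A C *%R counit_Omega counit_Omega_scalar.

Definition integral_Omega (a : A) : C := \sum_h ev (h, 1%g) a.

Fact integral_Omega_scalar : scalar integral_Omega.
Proof.
move=> c a b; rewrite /integral_Omega mulr_sumr -big_split; apply: eq_bigr => k _ /=.
by rewrite linearP.
Qed.

HB.instance Definition _ :=
  GRing.isLinear.Build C A C *%R integral_Omega integral_Omega_scalar.

Hypothesis OA : Omega_algebra.

(** * Evaluations, delta functions and the values of the structure maps on them *)

Lemma in_Omega h k : ((h, k) \in Omega H K) = (h == 1%g) || (k == 1%g).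
Proof. by rewrite inE. Qed.

Lemma in_OmegaV h k : ((h^-1, k^-1)%g \in Omega H K) = ((h, k) \in Omega H K).
Proof. by rewrite !in_Omega !invg_eq1. Qed.

Lemma ev_ext a b : (forall x, ev x a = ev x b) -> a = b.
Proof.
by move=> ab; rewrite (ev_sum OA a) (ev_sum OA b); apply: eq_bigr => x _; rewrite ab.
Qed.

Lemma delta0 x : x \notin Omega H K -> d x = 0.
Proof.
move=> xO; apply: ev_ext => y; rewrite linear0 (ev_delta OA).
by have [->|_] := eqVneq y x; rewrite ?(negPf xO) ?andbF.
Qed.

Lemma ev0 x a : x \notin Omega H K -> ev x a = 0.
Proof.
move=> xO; rewrite (ev_sum OA a) linear_sum big1 // => y _.
by rewrite linearZ /= (ev_delta OA) (negPf xO) mulr0.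
Qed.

Lemma delta0_neq1 h k : h != 1%g -> k != 1%g -> d (h, k) = 0.
Proof. by move=> h1 k1; rewrite delta0 // in_Omega negb_or h1. Qed.

(** Outside [Omega] the vector [d x] is zero, so the formula holds there only if [F x] vanishes
    too. *)
Lemma delta_extE (W : vectType C) (F : H * K -> W) x :
  (x \notin Omega H K -> F x = 0) -> delta_ext F (d x) = F x.
Proof.
move=> F0; rewrite /delta_ext (bigD1 x) //= big1 => [|y yx]; last first.
  by rewrite (ev_delta OA) (negPf yx) andbF scale0r.
rewrite (ev_delta OA) eqxx andbT addr0.
by case: (boolP (x \in _)) F0 => [_ _|_ ->] //=; rewrite ?scale1r ?scaler0.
Qed.

(** Delta functions span by [ev_sum]. Linearity is a plain hypothesis so that composite expressions
    can be compared without bundling them first. *)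
Lemma linear_delta (W : vectType C) (f g : A -> W) : linear f -> linear g ->
  (forall h k, f (d (h, k)) = g (d (h, k))) -> f =1 g.
Proof.
move=> fL gL fg a; rewrite (ev_sum OA a).
pose f' : {linear A -> W} := HB.pack f (GRing.isLinear.Build C A W *:%R f fL).
pose g' : {linear A -> W} := HB.pack g (GRing.isLinear.Build C A W *:%R g gL).
rewrite -[f]/(f' : _ -> _) -[g]/(g' : _ -> _) !linear_sum.
by apply: eq_bigr => -[h k] _; rewrite !linearZ_LR /= fg.
Qed.

Lemma Delta_delta h k :
  Delta (d (h, k)) = \sum_p tens (d (p, k)) (d ((p^-1 * h)%g, k)).
Proof.
rewrite [LHS]delta_extE //= in_Omega negb_or => /andP[h1 k1].
rewrite big1 // => p _; have [->|p1] := eqVneq p 1%g.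
  by rewrite invg1 mul1g (delta0_neq1 h1 k1) tens0r.
by rewrite (delta0_neq1 p1 k1) tens0l.
Qed.

Lemma antipode_delta h k : antipode (d (h, k)) = d (h^-1, k^-1)%g.
Proof. by rewrite [LHS]delta_extE //= -in_OmegaV => /delta0. Qed.

Lemma counit_delta h k : counit_Omega (d (h, k)) = (h == 1%g)%:R.
Proof.
rewrite /counit_Omega (bigD1 k) //= big1 => [|l lk]; last first.
  by rewrite (ev_delta OA) xpair_eqE (negPf lk) !andbF.
by rewrite (ev_delta OA) in_Omega xpair_eqE !eqxx addr0 /= andbT eq_sym.
Qed.

Lemma integral_delta h k : integral_Omega (d (h, k)) = (k == 1%g)%:R.
Proof.
rewrite /integral_Omega (bigD1 h) //= big1 => [|l lk]; last first.
  by rewrite (ev_delta OA) xpair_eqE (negPf lk) !andbF.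
by rewrite (ev_delta OA) in_Omega xpair_eqE !eqxx orbT addr0 eq_sym.
Qed.

Lemma one_delta : 1 = \sum_h d (h, 1%g).
Proof.
apply: ev_ext => -[h k]; rewrite (ev_one OA) linear_sum (bigD1 h) //=.
rewrite big1 => [|p ph]; last by rewrite (ev_delta OA) xpair_eqE eq_sym (negPf ph) andbF.
rewrite (ev_delta OA) in_Omega xpair_eqE eqxx addr0.
by case: eqVneq; rewrite ?orbT ?andbF.
Qed.

Lemma ev_antipode h k a : ev (h, k) (antipode a) = ev (h^-1, k^-1)%g a.
Proof.
rewrite /antipode /= /delta_ext linear_sum (bigD1 (h^-1, k^-1)%g) //=.
rewrite big1 => [|[p q] pq]; last first.
  rewrite linearZ /= (ev_delta OA) !xpair_eqE /= in pq *.
  by rewrite -(inj_eq invg_inj h) -(inj_eq invg_inj k) !invgK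
    !(eq_sym _^-1%g) (negPf pq) andbF mulr0.
rewrite linearZ /= (ev_delta OA) !invgK eqxx andbT addr0.
case: (boolP (_ \in _)) => [_|]; first by rewrite mulr1.
by rewrite -in_OmegaV => /ev0 ->; rewrite mul0r.
Qed.

(** The integral of [a * c] is the sum of [a(h,v) c(h,v^-1)] over [h] and [v], so a delta function
    picks out one value. The form is symmetric, whence the same value in [integral_deltar]. *)
Lemma integral_deltal h k c : integral_Omega (d (h, k) * c) = ev (h, k^-1)%g c.
Proof.
rewrite /integral_Omega (bigD1 h) //= big1 => [|l lh]; last first.
  rewrite (ev_mul OA) big1 // => v _.
  by rewrite (ev_delta OA) xpair_eqE (negPf lh) andbF mul0r.
rewrite (ev_mul OA) (bigD1 k) //= big1 => [|v vk]; last first.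
  by rewrite (ev_delta OA) xpair_eqE (negPf vk) !andbF mul0r.
rewrite (ev_delta OA) eqxx andbT !addr0 mulg1.
case: (boolP (_ \in _)) => [_|hkO]; first by rewrite mul1r.
by rewrite ev0 ?mulr0 // -in_OmegaV invgK in_Omega invg_eq1 -in_Omega.
Qed.

Lemma integral_deltar h k a : integral_Omega (a * d (h, k)) = ev (h, k^-1)%g a.
Proof.
rewrite /integral_Omega (bigD1 h) //= big1 => [|l lh]; last first.
  rewrite (ev_mul OA) big1 // => v _.
  by rewrite (ev_delta OA) xpair_eqE (negPf lh) andbF mulr0.
rewrite (ev_mul OA) (bigD1 k^-1%g) //= big1 => [|v vk]; last first.
  by rewrite (ev_delta OA) xpair_eqE mulg1 eq_invg_sym (negPf vk) !andbF mulr0.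
rewrite (ev_delta OA) mulg1 invgK eqxx andbT !addr0.
case: (boolP (_ \in _)) => [_|hkO]; first by rewrite mulr1.
by rewrite ev0 ?mul0r // -in_OmegaV invgK in_Omega invg_eq1 -in_Omega.
Qed.

(** * The axioms of a finite quantum hypergroup *)

Lemma Delta_coassociative : coassociative Delta.
Proof.
apply: linear_delta => [c a b|c a b|h k]; rewrite ?linearP //.
rewrite !Delta_delta !tmap_sum tassoc_sum.
under eq_bigr => p _ do rewrite tmap_tens Delta_delta tens_suml tassoc_sum.
(* Both sides become the sum over [p] and [q] of the tensors of [d(p,k)], [d(q,k)] and
   [d(q^-1 p^-1 h,k)]. *)
rewrite exchange_big /=; apply: eq_bigr => p _.
rewrite tmap_tens Delta_delta tens_sumr (reindex_inj (mulgI p)) /=.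
by apply: eq_bigr => q _; rewrite tassoc_tens mulKg invMg mulgA.
Qed.

Lemma Delta_one : Delta 1 = tens 1 1.
Proof.
rewrite one_delta tens_suml linear_sum; under eq_bigr do rewrite Delta_delta.
rewrite exchange_big; apply: eq_bigr => p _.
rewrite tens_sumr (reindex_inj (mulgI p)) /=.
by apply: eq_bigr => q _; rewrite mulKg.
Qed.

Lemma counit_OmegaP : is_counit Delta counit_Omega.
Proof.
move=> a; split; move: a; apply: linear_delta => [c a b|c a b|h k];
  rewrite ?linearP // Delta_delta ?slicel_sum ?slicer_sum.
  rewrite (bigD1 1%g) //= big1 => [|p p1]; rewrite slicel_tens /= counit_delta.
    by rewrite eqxx invg1 mul1g scale1r addr0.
  by rewrite (negPf p1) scale0r.
rewrite (bigD1 h) //= big1 => [|p ph]; rewrite slicer_tens /= counit_delta.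
  by rewrite mulVg eqxx scale1r addr0.
by rewrite -eq_mulVg1 (negPf ph) scale0r.
Qed.

(** Restriction to [h = 1] maps [A] to the group algebra of [K], and the counit is the augmentation
    there. *)
Lemma counit_Omega_monoid_morphism : monoid_morphism counit_Omega.
Proof.
split.
  rewrite /counit_Omega (bigD1 1%g) //= big1 => [|k /negPf k1].
    by rewrite (ev_one OA) eqxx addr0.
  by rewrite (ev_one OA) k1.
move=> a b; rewrite /counit_Omega mulr_suml.
under eq_bigr do rewrite (ev_mul OA).
rewrite exchange_big; apply: eq_bigr => v _.
rewrite -mulr_sumr (reindex_inj (mulgI v)) /=; congr (_ * _).
by apply: eq_bigr => k _; rewrite mulKg.
Qed.

Lemma integral_faithful : Defs.faithful integral_Omega.
Proof.
split=> a a0; apply: ev_ext => -[h k]; rewrite linear0.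
  by rewrite -[k]invgK -integral_deltar a0.
by rewrite -[k]invgK -integral_deltal a0.
Qed.

(** The antipode is its own inverse, and inversion in [K] reverses the order of convolution. *)
Lemma antipode_anti_isomorphism : anti_isomorphism antipode.
Proof.
split.
  apply: inv_bij => a; apply: ev_ext => -[h k].
  by rewrite !ev_antipode !invgK.
move=> a b; apply: ev_ext => -[h k].
rewrite ev_antipode !(ev_mul OA) (reindex_inj (mulgI k^-1%g)) /=.
apply: eq_bigr => v _; rewrite !ev_antipode mulrC !invMg !invgK.
by rewrite mulgK.
Qed.

Lemma slice_deltal h k c :
  slicer integral_Omega (tmul (Delta (d (h, k))) (tens 1 c))
    = \sum_p ev (p^-1 * h, k^-1)%g c *: d (p, k).
Proof.
rewrite Delta_delta tmul_suml slicer_sum; apply: eq_bigr => p _.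
by rewrite tmul_tens slicer_tens mulr1 /= integral_deltal.
Qed.

Lemma slice_deltar h k a :
  slicer integral_Omega (tmul (tens 1 a) (Delta (d (h, k))))
    = \sum_p ev (p^-1 * h, k^-1)%g a *: d (p, k).
Proof.
rewrite Delta_delta tmul_tens_sumr slicer_sum; apply: eq_bigr => p _.
by rewrite tmul_tens slicer_tens mul1r /= integral_deltar.
Qed.

(** For [a = d(h,k)] and [c = d(h',k')], once [p] is inverted on the left, the terms on both sides
    vanish unless [p h = h'] and [k' = k^-1], and are then multiples of [d(p,k')]. *)
Lemma integral_left : left_integral_with Delta integral_Omega antipode.
Proof.
move=> a c; move: a; apply: linear_delta => [e a b|e a b|h k].
- by rewrite /tmul !linearP.
- by rewrite tens_linearr /tmul !linearP.
rewrite slice_deltal; move: c; apply: linear_delta => [e a b|e a b|h' k'].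
- rewrite -linearP scaler_sumr -big_split; congr (antipode _).
  by apply: eq_bigr => p _; rewrite /= linearP scalerDl scalerA.
- by rewrite !tmul_tensl !linearP.
rewrite slice_deltar linear_sum (reindex_inj invg_inj); apply: eq_bigr => p _ /=.
rewrite linearZ_LR /= antipode_delta !invgK !(ev_delta OA) !xpair_eqE.
have -> : (p^-1 * h' == h)%g = (p * h == h')%g.
  by apply/eqP/eqP => <-; rewrite ?mulKVg ?mulKg.
have -> : (k^-1 == k')%g = (k'^-1 == k)%g by apply/eqP/eqP => <-; rewrite invgK.
case: (p * h =P h')%g => [<-|_]; last by rewrite !andbF !scale0r.
rewrite mulKg; case: (k'^-1 =P k)%g => [<-|_]; last by rewrite !andbF !scale0r.
rewrite !invgK !in_Omega invg_eq1.
(* The remaining coefficients ask whether [(p h, k')] and [(h, k')] lie in [Omega]. They can differ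
   only if [k'] and [p] are both nontrivial, and then [d(p,k') = 0]. *)
have [->|k1] := eqVneq k' 1%g; first by rewrite !orbT.
have [->|p1] := eqVneq p 1%g; first by rewrite mul1g.
by rewrite (delta0_neq1 p1 k1) !scaler0.
Qed.

(* Taking [c = 1] in the definition of a left integral shows that [phi] is    *)
(* invariant, which forces it to be a multiple of [integral_Omega].           *)
Lemma antipode_unique S : is_antipode Delta S -> S =1 antipode.
Proof.
case=> phi [[phi_nd _] phiS [Sbij SM]]; have Sinj := bij_inj Sbij.
have S1 : S 1 = 1.
  have [T _ ST] := Sbij; by rewrite -[RHS]ST -[T 1]mulr1 SM ST mulr1.
have phi_inv a : slicer phi (Delta a) = phi a *: 1.
  apply: Sinj; rewrite linearZ /= S1 -slicer_tens; have := phiS a 1.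
  rewrite Delta_one tmul_tens !mulr1 => <-; congr (S (slicer _ _)).
  move: a; apply: linear_delta => [e a b|e a b|h k].
  - by rewrite linearP.
  - by rewrite /tmul !linearP.
  rewrite [LHS](Delta_delta h k) Delta_delta tmul_suml; apply: eq_bigr => p _.
  by rewrite tmul_tens !mulr1.
(* Compare coefficients at [(p,k)] in the invariance of [phi], applied to [d(h,k)]. *)
have phi_ev h k p : (p, k) \in Omega H K ->
    phi (d (p^-1 * h, k)%g) = phi (d (h, k)) * (k == 1%g)%:R.
  move=> pkO; have /(congr1 (ev (p, k))) := phi_inv (d (h, k)).
  rewrite linearZ /= (ev_one OA) => <-.
  rewrite Delta_delta slicer_sum linear_sum (bigD1 p) //= big1 => [|q qp].
    rewrite slicer_tens linearZ /= (ev_delta OA) pkO eqxx mulr1 addr0.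
    by [].
  rewrite slicer_tens linearZ /= (ev_delta OA) xpair_eqE eq_sym (negPf qp).
  by rewrite andbF mulr0.
(* [p = 1] shows that [phi] kills [d(h,k)] for [k] nontrivial; [k = 1] and [p = h] moves [h] to the
   identity. *)
have phi_deltaE h k : phi (d (h, k)) = phi (d (1, 1)%g) * (k == 1%g)%:R.
  have := phi_ev h k 1%g; rewrite in_Omega eqxx invg1 mul1g => /(_ isT) ->.
  have [->|_] := eqVneq; last by rewrite !mulr0.
  have := phi_ev h 1%g h; rewrite in_Omega eqxx orbT mulVg => /(_ isT) ->.
  by rewrite !mulr1.
have phiE a : phi a = phi (d (1, 1)%g) * integral_Omega a.
  rewrite (ev_sum OA a) !linear_sum mulr_sumr; apply: eq_bigr => -[h k] _.
  by rewrite !linearZ /= phi_deltaE integral_delta mulrCA.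
have lambda_neq0 : phi (d (1, 1)%g) != 0.
  apply/eqP => l0; have /eqP := oner_neq0 A; apply.
  by apply: phi_nd => c; rewrite phiE l0 mul0r.
have phi_slice t : slicer phi t = phi (d (1, 1)%g) *: slicer integral_Omega t.
  rewrite scaler_sumr; apply: eq_bigr => i _; rewrite scaler_sumr.
  by apply: eq_bigr => j _; rewrite phiE !scalerA mulrCA mulrA.
apply: linear_delta => [c a b|c a b|h k]; rewrite ?linearP //.
(* With this [c] the only surviving term of the slice is [p = h], so every delta function is a
   slice, and the integral identity determines [S] on slices. *)
pose c := d (1%g, k^-1%g).
have -> : d (h, k) = slicer integral_Omega (tmul (Delta (d (h, k))) (tens 1 c)).
  rewrite slice_deltal (bigD1 h) //= big1 => [|p ph]; last first.
    by rewrite (ev_delta OA) xpair_eqE -eq_mulVg1 (negPf ph) andbF scale0r.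
  by rewrite mulVg (ev_delta OA) in_Omega !eqxx scale1r addr0.
rewrite integral_left; apply: (scalerI lambda_neq0).
by rewrite -linearZ -!phi_slice phiS.
Qed.

(** * Compatibility with the involution *)

Section OmegaStar.
Variable star : A -> A.
Hypothesis ev_star : forall h k a, ev (h, k) (star a) = (ev (h, k^-1)%g a)^*.

Lemma star_delta h k : star (d (h, k)) = d (h, k^-1)%g.
Proof.
apply: ev_ext => -[p q]; rewrite ev_star !(ev_delta OA) !xpair_eqE !in_Omega.
by rewrite invg_eq1 (inv_eq invgK) rmorph_nat.
Qed.

Lemma star_involution : is_involution star.
Proof.
split=> [c a b|a b|a]; apply: ev_ext => -[h k].
- by rewrite linearP !ev_star linearP rmorphD rmorphM.
- rewrite ev_star !(ev_mul OA) rmorph_sum (reindex_inj (mulgI k^-1%g)) /=.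
  apply: eq_bigr => v _; rewrite !ev_star rmorphM mulrC !invMg !invgK.
  by rewrite mulgK.
by rewrite !ev_star invgK conjCK.
Qed.

(** On delta functions [star] inverts [k] while [Delta] factors [h], so the two do not interfere. *)
Lemma Delta_star a : Delta (star a) = tstar star (Delta a).
Proof.
have [starL _ _] := star_involution.
rewrite (ev_sum OA a) (semilinear_sum _ _ _ starL) !(linear_sum Delta).
under [X in tstar _ X]eq_bigr do rewrite linearZ.
rewrite (semilinear_sum _ _ _ (tstar_semilinear star)); apply: eq_bigr => -[h k] _.
rewrite linearZ star_delta !Delta_delta tstar_sum; congr (_ *: _).
by apply: eq_bigr => p _; rewrite tstar_tens // !star_delta.
Qed.

Lemma Omega_finite_star_quantum_hypergroup :
  finite_star_quantum_hypergroup star Delta.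
Proof.
split; [split | exact: star_involution | exact: Delta_star].
- exact: Delta_coassociative.
- exact: Delta_one.
- exists counit_Omega; split; first exact: counit_OmegaP.
  exact: counit_Omega_monoid_morphism.
exists antipode, integral_Omega; split; first exact: integral_faithful.
  exact: integral_left.
exact: antipode_anti_isomorphism.
Qed.

End OmegaStar.
End OmegaAlgebra.

(** * Duality *)

(* The product of [B] is that of [A] with [H] and [K] exchanged.              *)
Section OmegaPairing.
Variables (C : numClosedFieldType) (H K : finGroupType) (A B : falgType C).
Variables (evA : H * K -> {scalar A}) (dA : H * K -> A).
Variables (evB : K * H -> {scalar B}) (dB : K * H -> B).
Hypotheses (OA : Omega_algebra evA dA) (OB : Omega_algebra evB dB).
Variable pair : A -> B -> C.
Hypothesis pairE :
  forall a b, pair a b = \sum_h \sum_k evA (h, k) a * evB (k, h) b.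

(** Holds outside [Omega] as well, where [evB] vanishes along with [dA]. *)
Lemma pair_deltal h k b : pair (dA (h, k)) b = evB (k, h) b.
Proof.
rewrite pairE (bigD1 h) //= (bigD1 k) //= big1 ?big1 => [|p ph|q qk]; first last.
- by rewrite (ev_delta OA) xpair_eqE (negPf qk) !andbF mul0r.
- by rewrite big1 // => q _; rewrite (ev_delta OA) xpair_eqE (negPf ph) andbF mul0r.
rewrite (ev_delta OA) eqxx andbT !addr0.
case: (boolP (_ \in _)) => [_|hkO]; first by rewrite mul1r.
by rewrite (ev0 OB) ?mulr0 // in_Omega orbC -in_Omega.
Qed.

Lemma pair_bilinear : bilinear_for *%R *%R pair.
Proof.
split=> [b c x y|a c x y] /=; rewrite !pairE mulr_sumr -big_split;
  apply: eq_bigr => h _; rewrite /= mulr_sumr -big_split; apply: eq_bigr => k _.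
  by rewrite /= linearP mulrDl mulrA.
by rewrite /= linearP mulrDr mulrCA.
Qed.

(** On [d(h,k)] both sides equal the sum of [b(k,p) b'(k,p^-1 h)] over [p], which is the convolution
    product of [B] at [(k,h)]. *)
Lemma Delta_induced : induced_coproductl pair (Delta evA dA).
Proof.
have bp := pair_bilinear; move=> a b b'; rewrite tpair_tensr //; have [pl pr] := bp.
move: a; apply: (linear_delta OA (W := C^o)) => [c x y|c x y|h k].
- by rewrite !linearP.
- exact: pl.
rewrite (Delta_delta OA) tlift_sum pair_deltal (ev_mul OB).
apply: eq_bigr => p _; rewrite tlift_tens ?pair_deltal //.
split=> [w c x y|w c x y] /=; first by rewrite pl mulrDl -mulrA.
by rewrite pl mulrDr mulrCA.
Qed.

End OmegaPairing.

Section OmegaDuality.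
Variables (C : numClosedFieldType) (H K : finGroupType) (A B : falgType C).
Variables (evA : H * K -> {scalar A}) (dA : H * K -> A).
Variables (evB : K * H -> {scalar B}) (dB : K * H -> B).
Variables (sA : A -> A) (sB : B -> B) (pair : A -> B -> C).

Lemma Omega_dual_pair :
  Omega_algebra evA dA -> Omega_algebra evB dB ->
  (forall h k a, evA (h, k) (sA a) = (evA (h, k^-1)%g a)^*) ->
  (forall h k b, evB (k, h) (sB b) = (evB (k, h^-1)%g b)^*) ->
  (forall a b, pair a b = \sum_h \sum_k evA (h, k) a * evB (k, h) b) ->
  dual_pair_of_finite_star_quantum_hypergroups sA sB pair.
Proof.
move=> OA OB evsA evsB pairE.
have pairE' b a : pair a b = \sum_k \sum_h evB (k, h) b * evA (h, k) a.
  rewrite pairE exchange_big; apply: eq_bigr => k _; apply: eq_bigr => h _.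
  exact: mulrC.
split; first exact: pair_bilinear pairE.
  split=> [a a0|b b0].
    apply: (ev_ext OA) => -[h k]; rewrite linear0.
    by rewrite -(pair_deltal OB OA (pair := fun b a => pair a b) pairE').
  by apply: (ev_ext OB) => -[k h]; rewrite linear0 -(pair_deltal OA OB pairE).
exists (Delta evA dA), (Delta evB dB); split.
- exact: (Delta_induced OA OB pairE).
- move=> a a' b; rewrite tpair_flip.
  exact: (Delta_induced OB OA (pair := fun b a => pair a b) pairE').
- exact: Omega_finite_star_quantum_hypergroup.
- by apply: Omega_finite_star_quantum_hypergroup => // k h b; exact: evsB.
move=> S /(antipode_unique OA) SE a b; rewrite !pairE rmorph_sum.
(* In [sA (antipode a)] the two inversions of [k] cancel and that of [h] remains; inverting the
   summation variable matches it with the inversion of [h] in [sB b]. *)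
rewrite (reindex_inj invg_inj); apply: eq_bigr => h _ /=.
rewrite rmorph_sum; apply: eq_bigr => k _ /=.
by rewrite evsB evsA SE (ev_antipode OA) rmorphM /= conjCK !invgK.
Qed.

End OmegaDuality.

(** * The algebras A and B *)

Section ConcreteAlgebras.
Variables (C : numClosedFieldType) (H K : finGroupType).

Definition evalA (x : H * K) (f : algA C H K) : C := (vsval f : FHxCK C H K) x.
Definition evalB (x : K * H) (g : algB C H K) : C :=
  (vsval g : CHxFK C H K) (x.2, x.1).

Fact evalA_scalar x : scalar (evalA x).
Proof. by move=> c f g; rewrite /evalA linearP !ffunE. Qed.

Fact evalB_scalar x : scalar (evalB x).
Proof. by move=> c f g; rewrite /evalB linearP !ffunE. Qed.

HB.instance Definition _ x :=
  GRing.isLinear.Build C (algA C H K) C *%R (evalA x) (evalA_scalar x).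
HB.instance Definition _ x :=
  GRing.isLinear.Build C (algB C H K) C *%R (evalB x) (evalB_scalar x).

Definition dirac (x : H * K) : {ffun H * K -> C^o} :=
  [ffun y => ((x \in Omega H K) && (y == x))%:R].

Fact dirac_supp x : dirac x \in suppOmega C H K.
Proof.
apply/suppOmegaP => h k h1 k1; rewrite ffunE.
have [<-|_] := eqVneq (h, k) x; last by rewrite andbF.
by rewrite in_Omega (negPf h1) (negPf k1).
Qed.

Definition deltaA (x : H * K) : algA C H K := Subvs (dirac_supp x).
Definition deltaB (x : K * H) : algB C H K := Subvs (dirac_supp (x.2, x.1)).

Lemma evalA_delta x y :
  evalA x (deltaA y) = ((x \in Omega H K) && (x == y))%:R.
Proof. by rewrite [LHS]ffunE; case: eqVneq => [->|_]; rewrite ?andbF. Qed.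

Lemma evalB_delta x y :
  evalB x (deltaB y) = ((x \in Omega K H) && (x == y))%:R.
Proof.
case: x y => [k h] [q p]; rewrite [LHS]ffunE !xpair_eqE !in_Omega andbC /=.
rewrite (andbC (h == p)) orbC.
by case: eqVneq => [->|_]; case: eqVneq => [->|_]; rewrite ?andbF ?andbT.
Qed.

Lemma evalA0 x f : x \notin Omega H K -> evalA x f = 0.
Proof.
case: x => h k; rewrite in_Omega negb_or => /andP[h1 k1].
by have /suppOmegaP f0 := subvsP f; exact: f0.
Qed.

Lemma evalB0 x g : x \notin Omega K H -> evalB x g = 0.
Proof.
case: x => k h; rewrite in_Omega negb_or => /andP[k1 h1].
by have /suppOmegaP g0 := subvsP g; exact: g0.
Qed.

Lemma algA_Omega : Omega_algebra evalA deltaA.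
Proof.
split=> [|a|h k a b|h k]; first exact: evalA_delta.
- apply: val_inj; apply/ffunP => y; rewrite -[LHS]/(evalA y a) -[RHS]/(evalA y _).
  rewrite linear_sum (bigD1 y) //= big1 => [|x xy].
    rewrite linearZ /= evalA_delta eqxx andbT addr0.
    by case: (boolP (_ \in _)) => [_|/evalA0 ->]; rewrite ?mulr1 ?mul0r.
  by rewrite linearZ /= evalA_delta eq_sym (negPf xy) andbF mulr0.
- by rewrite [LHS]ffunE.
by have /ffunP/(_ (h, k)) := one_algA C H K; rewrite ffunE => <-.
Qed.

Lemma algB_Omega : Omega_algebra evalB deltaB.
Proof.
split=> [|a|k h a b|k h]; first exact: evalB_delta.
- apply: val_inj; apply/ffunP => -[h k].
  rewrite -[LHS]/(evalB (k, h) a) -[RHS]/(evalB (k, h) _).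
  rewrite linear_sum (bigD1 (k, h)) //= big1 => [|x xy].
    rewrite linearZ /= evalB_delta eqxx andbT addr0.
    by case: (boolP (_ \in _)) => [_|/evalB0 ->]; rewrite ?mulr1 ?mul0r.
  by rewrite linearZ /= evalB_delta eq_sym (negPf xy) andbF mulr0.
(* The substitution [u = v^-1 h] turns the factors at [h u^-1] and [u] into those at [v] and
   [v^-1 h], the form of [ev_mul]. *)
- rewrite [LHS]ffunE (reindex_inj (mulIg h)) (reindex_inj invg_inj) /=.
  by apply: eq_bigr => v _; rewrite invMg invgK mulKVg.
by have /ffunP/(_ (h, k)) := one_algB C H K; rewrite ffunE => <-.
Qed.

Theorem suppOmega_dual_pair :
  dual_pair_of_finite_star_quantum_hypergroups
    (@starA C H K) (@starB C H K) (@pairAB C H K).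
Proof.
apply: (Omega_dual_pair algA_Omega algB_Omega) => [h k a|h k b|a b].
- by rewrite [LHS]ffunE.
- by rewrite [LHS]ffunE.
(* Elements of [A] vanish outside [Omega], so the sum over [Omega] extends to all pairs. *)
rewrite pair_big /= /pairAB [RHS](bigID [in Omega H K]) /=.
rewrite [X in _ + X]big1 ?addr0 => [|x /evalA0 a0]; last first.
  by rewrite -surjective_pairing a0 mul0r.
by apply: eq_bigr => -[].
Qed.

End ConcreteAlgebras.

Local Open Scope complex_scope.

Theorem theorem6p16 (R : realType) (G : groupType) (H K : fin_subgroup G)
    (HK1 : (H `&` K = [fset 1%g])%fset)
    (HK2 : (set_prod H K `&` set_prod K H = H `|` K)%fset) :
  dual_pair_of_finite_star_quantum_hypergroups
    (@starA R[i] (fsubg H) (fsubg K)) (@starB R[i] (fsubg H) (fsubg K))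
    (@pairAB R[i] (fsubg H) (fsubg K)).
Proof. exact: suppOmega_dual_pair. Qed.
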